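(* There exists an absolute constant $\varepsilon_0>0$ such that for every $0<\varepsilon\le\varepsilon_0$ there is a constant $\gamma=\gamma(\varepsilon)>0$, depending only on $\varepsilon$, for which the following holds. Let $k,d\in\mathbb{N}$ be positive integers, let $p=\frac{1+\varepsilon}{d}$ with $p\le 1$, and let $G$ be a finite graph on at least $k$ vertices such that every $S\subseteq V(G)$ with $|S|=k$ satisfies $|N(S)|\ge kd$. Then the random subgraph $G_p$ contains a path of length at least $\frac{\varepsilon^2kd}{10}$ with probability at least $1-\exp(-\gamma kd)$.
   Context: Graphs are finite and simple. For a graph $G$ and $S\subseteq V(G)$, $N(S)=\{v\in V(G)\setminus S:\exists u\in S,\ \{u,v\}\in E(G)\}$ is the external neighbourhood of $S$ in $G$. For $p\in[0,1]$, $G_p$ denotes the random subgraph of $G$ on vertex set $V(G)$ obtained by retaining each edge of $G$ independently with probability $p$. The length of a path is its number of edges. Rounding signs are omitted throughout (they are immaterial to the asymptotic statement). *)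

(* Defs.v *)
From HB Require Import structures.
From mathcomp Require Import all_boot all_order all_algebra.
From mathcomp Require Import boolp reals.

Set Implicit Arguments.
Unset Strict Implicit.
Unset Printing Implicit Defensive.

Import Order.TTheory GRing.Theory Num.Theory.

Local Open Scope ring_scope.

(* A finite simple graph is a symmetric irreflexive relation e on a finType V;
   an edge is the unordered pair [set x; y] of its endpoints. *)

Section Graph.
Variables (V : finType) (e : rel V).

Definition edges : {set {set V}} :=
  [set E : {set V} | [exists x, exists y, e x y && (E == [set x; y])]].

Definition ext_nbhd (S : {set V}) : {set V} :=
  [set v | (v \notin S) && [exists u in S, e u v]].

End Graph.

(* The spanning subgraph with edge set F. It is loopless when F is a subset of
   edges e with e irreflexive, as then no singleton belongs to F. *)
Definition adj (V : finType) (F : {set {set V}}) : rel V :=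
  fun x y => [set x; y] \in F.

(* x :: s lists the vertices of the path, so its length (number of edges) is
   size s. *)
Definition has_path_of_length_ge (R : realType) (V : finType) (g : rel V)
    (l : R) : Prop :=
  exists (x : V) (s : seq V), [/\ path g x s, uniq (x :: s) & l <= (size s)%:R].

(* The law of the edge set of G_p: each edge of e is retained independently
   with probability p. Events are properties of the retained edge set F. *)
Definition Gp_prob (R : realType) (V : finType) (e : rel V) (p : R)
    (A : {set {set V}} -> Prop) : R :=
  \sum_(F : {set {set V}} | (F \subset edges e) && `[< A F >])
     p ^+ #|F| * (1 - p) ^+ #|edges e :\: F|.

(* Any given edges are all retained with the product probability; for
   B = set0 this says that the total mass is 1. *)
Lemma Gp_prob_retained (R : realType) (V : finType) (e : rel V) (p : R)
    (B : {set {set V}}) :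
  B \subset edges e -> Gp_prob e p (fun F => B \subset F) = p ^+ #|B|.
Proof.
move=> BE; rewrite /Gp_prob; set E := edges e.
pose a (i : {set V}) : R := if i \in E then p else 0.
pose b (i : {set V}) : R :=
  if i \in E then (if i \in B then 0 else 1 - p) else 1.
have <- : \prod_i (a i + b i) = p ^+ #|B|.
  rewrite (bigID [in B]) /= [X in _ * X]big1 ?mulr1 => [|i /negPf iB].
    rewrite -prodr_const; apply: eq_bigr => i iB.
    by rewrite /a /b iB (subsetP BE _ iB) addr0.
  by rewrite /a /b iB; case: (i \in E); rewrite ?add0r // addrC subrK.
rewrite bigA_distr big_mkcond /=; apply: eq_bigr => F _.
case: ifPn => [/andP[FE /asboolP BF]|].
  rewrite (bigID [in F]) /= -!prodr_const; congr (_ * _).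
    by apply: eq_bigr => i iF; rewrite iF /a (subsetP FE _ iF).
  rewrite [RHS](bigID [in E]) /= [X in _ = _ * X]big1 ?mulr1.
    rewrite (eq_bigl (fun i => (i \notin F) && (i \in E))).
      apply: eq_bigr => i /andP[iF iE]; rewrite (negPf iF) /b iE.
      by rewrite (contraNF (subsetP BF i) iF).
    by move=> i; rewrite inE.
  by move=> i /andP[iF iE]; rewrite (negPf iF) /b (negPf iE).
rewrite negb_and => /orP[/subsetPn[i iF iE]|/asboolPn/negP/subsetPn[i iB iF]].
  by rewrite (bigD1 i) //= iF /a (negPf iE) mul0r.
by rewrite (bigD1 i) //= (negPf iF) /b (subsetP BE _ iB) iB mul0r.
Qed.

(* Main.v *)
Require Import Defs.
From HB Require Import structures.
From mathcomp Require Import all_boot all_order all_algebra.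
From mathcomp Require Import boolp reals sequences exp.
From mathcomp Require Import zify ring lra.

Set Implicit Arguments.
Unset Strict Implicit.
Unset Printing Implicit Defensive.

Import Order.TTheory GRing.Theory Num.Theory.

(** Explore the random graph by depth-first search, revealing an edge only when
    the search asks for it. At any time the vertices are split into the set S
    of finished vertices, the stack U, which is a path of retained edges, and
    the untouched vertices T. A vertex leaves the stack for S only when all its
    edges to T have been revealed and found absent, so there are no retained
    edges between S and T.

    Stop when |S| = kj, with j about eps d / 2. If no long path exists then
    the stack holds u < eps^2 kd / 10 vertices at that time. Every k-subset A
    of S has at least kd - (kj - k) - u neighbours in T; cutting S into j such
    subsets yields at least j (kd - k (j - 1) - u) revealed absent edges
    ([dfs_negative_ge]). The retained edges found so far form a forest on S and
    U, so there are at most kj + u of them. With retention probability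
    (1 + eps) / d one expects noticeably more: the deficit is of order
    eps^2 kd ([dfs_drift]), and this is exponentially unlikely.

    The concentration step is a change of measure rather than a Chernoff bound
    at a fixed number of queries. Let q be slightly smaller than p. A record
    (P, Q) of the search, meaning that the set Q of edges has been revealed and
    P is its retained part, has probability p^|P| (1 - p)^|Q \ P| under p and
    q^|P| (1 - q)^|Q \ P| under q. If at each stopping record without a long
    path the first is at most C times the second ([bernoulli_tilt] gives
    C = exp (- gamma kd) from the deficit), then summing over the stopping
    records bounds the probability of having no long path by C, as the
    q-probabilities sum to at most 1. This summation is carried out backwards,
    along the search ([dfs_cyl_mass_le]): the bound by C times the
    q-probability passes from the two outcomes of a query to the record before
    the query ([cyl_mass_query]). No rounding of a number of queries occurs,
    which is why the estimate holds for all k and d, however small. *)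

Local Open Scope ring_scope.

(** * Revealing edges one at a time *)

(** The mass, under the law of G_p, of the event A inside the cylinder of
    outcomes whose trace on the revealed edges Q is P. It is not divided by the
    mass of the cylinder, which keeps p = 1 from being a special case. *)
Definition cyl_mass (R : realType) (V : finType) (e : rel V) (p : R)
    (A : {set {set V}} -> Prop) (P Q : {set {set V}}) : R :=
  \sum_(F : {set {set V}} | [&& F \subset edges e, F :&: Q == P & `[< A F >]])
     p ^+ #|F| * (1 - p) ^+ #|edges e :\: F|.

Section TraceExtension.
Variables (T : finType) (F P Q : {set T}) (x : T).
Hypotheses (PQ : P \subset Q) (xQ : x \notin Q).

Let xP : x \notin P.
Proof. by apply: contra xQ; apply: subsetP. Qed.

Lemma trace_setU1_in : (F :&: Q == P) && (x \in F) = (F :&: (x |: Q) == x |: P).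
Proof.
apply/andP/eqP => [[/eqP <- xF]|FQ].
  by rewrite setIUr (setIidPr _) ?sub1set.
have xF : x \in F by have := setU11 x P; rewrite -FQ inE => /andP[].
split=> //; apply/eqP; apply/setP => y; have /setP/(_ y) := FQ.
by rewrite !inE; case: eqP => [->|//] _; rewrite (negPf xQ) (negPf xP) andbF.
Qed.

Lemma trace_setU1_notin : (F :&: Q == P) && (x \notin F) = (F :&: (x |: Q) == P).
Proof.
apply/andP/eqP => [[/eqP <- xF]|FQ].
  by apply/setP => y; rewrite !inE; case: eqP => [->|//]; rewrite (negPf xF).
have xF : x \notin F by apply: contra xP => xF; rewrite -FQ inE xF setU11.
split=> //; apply/eqP; apply/setP => y; have /setP/(_ y) := FQ.
by rewrite !inE; case: eqP => [->|//] _; rewrite (negPf xQ) (negPf xP) andbF.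
Qed.

End TraceExtension.

Section CylinderMass.
Variables (R : realType) (V : finType) (e : rel V).
Implicit Types (p q C : R) (A : {set {set V}} -> Prop).
Implicit Types (P Q : {set {set V}}) (E : {set V}).

Lemma cyl_mass_split p A P Q E : P \subset Q -> E \notin Q ->
  cyl_mass e p A P Q =
  cyl_mass e p A (E |: P) (E |: Q) + cyl_mass e p A P (E |: Q).
Proof.
move=> PQ EQ; rewrite /cyl_mass (bigID (fun F : {set {set V}} => E \in F)) /=.
congr (_ + _); apply: eq_bigl => F.
  by rewrite -trace_setU1_in //; case: (E \in F); rewrite ?andbF ?andbT.
by rewrite -trace_setU1_notin //; case: (E \in F); rewrite ?andbF ?andbT.
Qed.

(** The right-hand sides of the two hypotheses add up to that of the conclusion
    because q + (1 - q) = 1; nothing relates q to p here, and it is this freedom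
    that allows the comparison of two retention probabilities. *)
Lemma cyl_mass_query p q C A P Q E : P \subset Q -> E \notin Q ->
  cyl_mass e p A (E |: P) (E |: Q)
    <= C * (q ^+ #|E |: P| * (1 - q) ^+ #|(E |: Q) :\: (E |: P)|) ->
  cyl_mass e p A P (E |: Q) <= C * (q ^+ #|P| * (1 - q) ^+ #|(E |: Q) :\: P|) ->
  cyl_mass e p A P Q <= C * (q ^+ #|P| * (1 - q) ^+ #|Q :\: P|).
Proof.
move=> PQ EQ; have EP : E \notin P by apply: contra EQ; apply: subsetP.
have -> : (E |: Q) :\: (E |: P) = Q :\: P.
  by apply/setP=> x; rewrite !inE; case: eqP => [->|//]; rewrite (negPf EQ) andbF.
have -> : (E |: Q) :\: P = E |: (Q :\: P).
  by apply/setP=> x; rewrite !inE; case: eqP => [->|//]; rewrite EP.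
rewrite (cyl_mass_split p A PQ EQ) !cardsU1 EP inE (negPf EQ) andbF /=.
rewrite !add1n !exprS => le1 le2; apply: le_trans (lerD le1 le2) _.
set a := q ^+ _; set b := (1 - q) ^+ _.
have <- : C * (q * a * b) + C * (a * ((1 - q) * b)) = C * (a * b) by ring.
exact: lexx.
Qed.

Lemma cyl_mass_le p A P Q : 0 <= p -> p <= 1 -> P \subset Q -> Q \subset edges e ->
  cyl_mass e p A P Q <= p ^+ #|P| * (1 - p) ^+ #|Q :\: P|.
Proof.
move=> p0 p1; move En : #|edges e :\: Q| => n.
elim: n => [|n IHn] in P Q En * => PQ QE.
  have EQ : Q = edges e.
    apply/eqP; rewrite eqEsubset QE -setD_eq0; exact/eqP/cards0_eq.
  have w0 : 0 <= p ^+ #|P| * (1 - p) ^+ #|Q :\: P|.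
    by rewrite mulr_ge0 // exprn_ge0 // subr_ge0.
  rewrite EQ in PQ w0 *; rewrite /cyl_mass.
  have only_P (F : {set {set V}}) : F \subset edges e -> F :&: edges e == P -> F = P.
    by move=> /setIidPl -> /eqP.
  have [AP|nAP] := pselect (A P).
    rewrite (big_pred1 P) // => F; apply/and3P/eqP => [[FE FP _]|->].
      exact: only_P.
    by split=> //; [apply/eqP/setIidPl | apply/asboolP].
  rewrite big1 // => F /and3P[FE FP /asboolP AF]; case: nAP.
  by rewrite -(only_P F).
have /card_gt0P[E] : (0 < #|edges e :\: Q|)%N by rewrite En.
rewrite inE => /andP[EQ EE].
have QE' : E |: Q \subset edges e by rewrite subUset sub1set EE.
have En' : #|edges e :\: (E |: Q)| = n.
  have -> : edges e :\: (E |: Q) = (edges e :\: Q) :\ E.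
    by apply/setP=> x; rewrite !inE negb_or andbA.
  by move: En; rewrite (cardsD1 E) inE EQ EE => -[].
rewrite -[leRHS]mul1r; apply: (cyl_mass_query PQ EQ); rewrite mul1r.
  by apply: IHn => //; apply: setUS.
by apply: IHn => //; apply: subset_trans PQ (subsetUr _ _).
Qed.

Lemma Gp_prob_compl p A :
  Gp_prob e p A = 1 - cyl_mass e p (fun F => ~ A F) set0 set0.
Proof.
suff total : Gp_prob e p A + cyl_mass e p (fun F => ~ A F) set0 set0 = 1.
  by rewrite -total addrK.
rewrite -(expr0 p) -(cards0 {set V}) -(Gp_prob_retained p (sub0set (edges e))).
rewrite /Gp_prob [RHS](bigID (fun F => `[< A F >])) /= /cyl_mass.
congr (_ + _); apply: eq_bigl => F; rewrite sub0set (asboolT isT) andbT //.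
by rewrite setI0 eqxx asbool_neg.
Qed.

End CylinderMass.

(** * Counting the edges between two sets *)

Section CrossingEdges.
Variables (V : finType) (e : rel V).
Implicit Types (A S T : {set V}) (D : {set {set V}}).

(** Neighbourhoods of disjoint k-subsets may overlap, but the edges leaving
    these subsets do not: hence the bound is multiplied by the number of subsets
    that S can be cut into. *)
Lemma sum_degree_ge_chunks T (k c j : nat) S : #|S| = (k * j)%N ->
  (forall A, A \subset S -> #|A| = k -> (c <= #|ext_nbhd e A :&: T|)%N) ->
  (j * c <= \sum_(x in S) #|[set y in T | e x y]|)%N.
Proof.
elim: j S => [//|j IHj] S cardS expS.
have /card_geqP[s [us ss sS]] : (k <= #|S|)%N by rewrite cardS leq_pmulr.
pose A := [set x in s].
have AS : A \subset S by apply/subsetP => x; rewrite inE => /sS.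
have cardA : #|A| = k by rewrite cardsE (card_uniqP us).
rewrite (big_setID A) /= (setIidPr AS) mulSn leq_add //.
  apply: leq_trans (expS A AS cardA) _.
  pose N := \bigcup_(x in A) [set y in T | e x y].
  apply: (@leq_trans #|N|).
    apply/subset_leq_card/subsetP => y; rewrite !inE => /andP[/andP[_ /existsP[x]]].
    by case/andP=> xA exy yT; apply/bigcupP; exists x; rewrite // inE yT.
  rewrite /N; elim/big_rec2: _ => [|x n B _ leBn]; first by rewrite cards0.
  by apply: leq_trans (leq_card_setU _ _) _; rewrite leq_add2l.
apply: IHj => [|B /subsetP BSA cardB].
  by rewrite cardsD (setIidPr AS) cardS cardA mulnS addKn.
by apply: expS cardB; apply/subsetP => x /BSA; rewrite inE => /andP[].
Qed.

Lemma sum_degree_le_card S T D : [disjoint S & T] ->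
  (forall x y, x \in S -> y \in T -> e x y -> [set x; y] \in D) ->
  (\sum_(x in S) #|[set y in T | e x y]| <= #|D|)%N.
Proof.
move=> dST STD.
pose X := [set z : V * V | [&& z.1 \in S, z.2 \in T & e z.1 z.2]].
have -> : (\sum_(x in S) #|[set y in T | e x y]| = #|X|)%N.
  under eq_bigr do rewrite -sum1_card.
  rewrite pair_big_dep /= -sum1_card; apply: eq_bigl => -[x y].
  by rewrite !inE.
have injX : {in X &, injective (fun z : V * V => [set z.1; z.2])}.
  move=> [x y] [x' y']; rewrite !inE /= => /and3P[xS yT _] /and3P[xS' yT' _] eqs.
  have neq u v : u \in S -> v \in T -> (u == v) = false.
    by move=> uS vT; apply: contraTF uS => /eqP->; rewrite (disjointFl dST vT).
  have := set21 x y; rewrite eqs !inE (neq x y') // orbF => /eqP ->.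
  by have := set22 x y; rewrite eqs !inE eq_sym (neq x' y) //= => /eqP ->.
rewrite -(card_in_imset injX) subset_leq_card //.
by apply/subsetP => _ /imsetP[[x y] + ->]; rewrite inE => /and3P[*]; apply: STD.
Qed.

End CrossingEdges.

(** * Depth-first search *)

Section DepthFirstSearch.
Variables (V : finType) (e : rel V).
Implicit Types (S : {set V}) (U : seq V) (P Q : {set {set V}}).

Definition untouched S U : {set V} := [set y | (y \notin S) && (y \notin U)].

Lemma untouched_push S U y : untouched S (y :: U) = untouched S U :\ y.
Proof. by apply/setP => z; rewrite !inE negb_or andbCA. Qed.

Lemma untouched_pop S U x : untouched (x |: S) U = untouched S (x :: U).
Proof.
by apply/setP => y; rewrite !inE !negb_or; case: (y == x); rewrite ?andbF.
Qed.

(** A moment of the search: S is the set of finished vertices, U the stack with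
    its top first, Q the set of revealed edges and P its retained part. The
    field [dfs_fresh] makes the revealed edges from S to the untouched vertices
    absent ones. The field [dfs_count] is the forest bound, weakened by the
    number of trees, so that starting a new tree preserves it. *)
Record dfs_state S U P Q : Prop := DfsState {
  dfs_uniq : uniq U;
  dfs_disjoint : forall x, x \in U -> x \notin S;
  dfs_path : sorted (adj P) U;
  dfs_pos : P \subset Q;
  dfs_queried : Q \subset edges e;
  dfs_fresh : forall E y, E \in P -> y \in E -> y \notin untouched S U;
  dfs_done : forall x y, x \in S -> y \in untouched S U -> e x y -> [set x; y] \in Q;
  dfs_count : (#|P| <= #|S| + size U)%N
}.

Lemma dfs_state_init : dfs_state set0 [::] set0 set0.
Proof.
by split=> //; rewrite ?sub0set ?cards0 // => x y; rewrite inE.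
Qed.

Lemma dfs_state_root S P Q v : dfs_state S [::] P Q -> v \notin S ->
  dfs_state S [:: v] P Q.
Proof.
case=> _ _ _ PQ QE fresh dn cnt vS.
have sub y : y \in untouched S [:: v] -> y \in untouched S [::].
  by rewrite untouched_push => /setD1P[].
split=> //=.
- by move=> x; rewrite inE => /eqP->.
- by move=> E y EP yE; apply/negP => /sub; apply/negP/(fresh E).
- by move=> x y xS /sub; apply: dn.
- by apply: leq_trans cnt _; rewrite leq_add2l.
Qed.

Lemma dfs_state_neg S x U P Q y : dfs_state S (x :: U) P Q -> e x y ->
  dfs_state S (x :: U) P ([set x; y] |: Q).
Proof.
case=> uU dU pU PQ QE fresh dn cnt exy; split=> //.
- exact: subset_trans PQ (subsetUr _ _).
- rewrite subUset QE sub1set inE andbT.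
  by apply/existsP; exists x; apply/existsP; exists y; rewrite exy eqxx.
- by move=> u w uS wT euw; rewrite inE dn // orbT.
Qed.

Lemma dfs_state_pos S x U P Q y : dfs_state S (x :: U) P Q -> e x y ->
  y \in untouched S (x :: U) ->
  dfs_state S [:: y, x & U] ([set x; y] |: P) ([set x; y] |: Q).
Proof.
move=> st exy yT; have [_ _ _ _ QE' _ _ _] := dfs_state_neg st exy.
case: st => uU dU pU PQ QE fresh dn cnt.
move: (yT); rewrite inE => /andP[yS yU].
have sub z : z \in untouched S [:: y, x & U] -> z \in untouched S (x :: U).
  by rewrite untouched_push => /setD1P[].
split=> //.
- by rewrite cons_uniq yU.
- by move=> z; rewrite inE => /orP[/eqP->|/dU].
- rewrite /= {1}/adj setUC setU11 /=.
  by apply: sub_path pU => u w; rewrite /adj inE orbC => ->.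
- exact: setUS.
- move=> E z /setU1P[->|EP zE]; last by apply/negP => /sub; apply/negP/(fresh E).
  by case/set2P => ->; rewrite !inE eqxx ?orbT andbF.
- by move=> u w uS /sub wT euw; rewrite inE dn // orbT.
- rewrite cardsU1 /= addnS; apply: leq_trans (leq_add (leq_b1 _) cnt) _.
  by rewrite add1n.
Qed.

Lemma dfs_state_pop S x U P Q : dfs_state S (x :: U) P Q ->
  (forall y, y \in untouched S (x :: U) -> e x y -> [set x; y] \in Q) ->
  dfs_state (x |: S) U P Q.
Proof.
case=> /= /andP[xU uU] dU pU PQ QE fresh dn cnt xdone.
split=> //; rewrite ?untouched_pop //.
- move=> y yU; rewrite in_setU1 negb_or dU ?inE ?yU ?orbT // andbT.
  by apply: contraNneq xU => <-.
- exact: path_sorted pU.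
- by move=> u w /setU1P[->|uS] wT; [apply: xdone|apply: dn].
- by rewrite cardsU1 dU ?mem_head // add1n addSnnS.
Qed.

End DepthFirstSearch.

(** The bound assumed at the stopping time holds throughout the search, by
    induction on what is left to do; only queries branch, and the other moves
    leave P and Q as they are. The search stops when m vertices are finished;
    that it gets there is due to m <= #|V|. At the stop, the vertex x
    just finished still extends the stack U to a path, so that a stack of u
    vertices witnesses a path with u edges and not just u - 1. *)
Lemma dfs_cyl_mass_le (R : realType) (V : finType) (e : rel V) (p q C : R)
    (A : {set {set V}} -> Prop) (m : nat) :
  (0 < m <= #|V|)%N ->
  (forall S x U P Q, dfs_state e S U P Q -> #|S| = m ->
     uniq (x :: U) -> path (adj P) x U ->
     cyl_mass e p A P Q <= C * (q ^+ #|P| * (1 - q) ^+ #|Q :\: P|)) ->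
  cyl_mass e p A set0 set0 <= C.
Proof.
move=> /andP[m0 mV] stop.
have drop_edge (Q : {set {set V}}) (E : {set V}) : E \in edges e -> E \notin Q ->
    #|edges e :\: Q| = #|edges e :\: (E |: Q)|.+1.
  move=> EE EQ; rewrite (cardsD1 E) inE EE EQ add1n; congr _.+1; apply: eq_card.
  by move=> E'; rewrite !inE negb_or andbA.
have drop_vertex (S : {set V}) (U : seq V) (y : V) : y \in untouched S U ->
    #|untouched S U| = #|untouched S (y :: U)|.+1.
  by move=> yT; rewrite untouched_push (cardsD1 y) yT.
suff main n S U P Q : dfs_state e S U P Q -> (#|S| < m)%N ->
    (#|edges e :\: Q| + 2 * #|untouched S U| + size U < n)%N ->
    cyl_mass e p A P Q <= C * (q ^+ #|P| * (1 - q) ^+ #|Q :\: P|).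
  have := main _ _ _ _ _ (dfs_state_init e).
  by rewrite set0D !cards0 !expr0 !mulr1; apply.
(* The measure decreases in all moves: an untouched vertex weighs 2, a stacked
   one 1 and a finished one 0, and an unrevealed edge weighs 1. *)
elim: n S U P Q => [//|n IHn] S [|x U] P Q st Sm meas.
- have [v vS] : exists v, v \notin S.
    apply/existsP; rewrite -negb_forall; apply: contraL Sm => /forallP SV.
    rewrite -leqNgt (leq_trans mV) // -cardsT subset_leq_card //.
    exact/subsetP.
  apply: IHn (dfs_state_root st vS) Sm _.
  have := drop_vertex S [::] v; rewrite inE vS => /(_ isT).
  by move: meas => /=; lia.
- have [done|] := boolP [forall y in untouched S (x :: U),
                           e x y ==> ([set x; y] \in Q)].
    have st' : dfs_state e (x |: S) U P Q.
      apply: dfs_state_pop st _ => y yT exy.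
      by have /forall_inP/(_ _ yT)/implyP := done; apply.
    have cardS : #|x |: S| = #|S|.+1.
      by rewrite cardsU1 (dfs_disjoint st) ?mem_head.
    have [eqm|neqm] := eqVneq #|x |: S| m.
      apply: stop st' eqm _ (dfs_path st); exact: dfs_uniq st.
    apply: IHn st' _ _; first by rewrite ltn_neqAle neqm cardS.
    by move: meas; rewrite untouched_pop /=; lia.
  case/forall_inPn => y yT; rewrite negb_imply => /andP[exy xyQ].
  have stp := dfs_state_pos st exy yT; have stn := dfs_state_neg st exy.
  have xyE : [set x; y] \in edges e.
    exact: subsetP (dfs_queried stn) _ (setU11 _ _).
  have dropE := drop_edge _ _ xyE xyQ.
  have dropV := drop_vertex _ _ _ yT.
  apply: (cyl_mass_query (dfs_pos st) xyQ).
    apply: IHn stp Sm _; move: meas dropE dropV => /=; lia.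
  apply: IHn stn Sm _; move: meas dropE => /=; lia.
Qed.

(** * The search in an expander *)

(** A neighbour of a k-subset A of S that is not untouched lies in the rest of
    S, which has k (j - 1) vertices, or on the stack. *)
Lemma dfs_negative_ge (V : finType) (e : rel V) (k d j : nat)
    (S : {set V}) (U : seq V) (P Q : {set {set V}}) :
  (forall A : {set V}, #|A| = k -> (k * d <= #|ext_nbhd e A|)%N) ->
  dfs_state e S U P Q -> #|S| = (k * j)%N ->
  (j * (k * d - (k * j.-1 + size U)) <= #|Q :\: P|)%N.
Proof.
move=> expG st cardS; pose T := untouched S U.
have dST : [disjoint S & T].
  rewrite disjoint_sym disjoints_subset; apply/subsetP => y.
  by rewrite !inE => /andP[].
apply: leq_trans (sum_degree_le_card (e := e) (D := Q :\: P) dST _); last first.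
  move=> x y xS yT exy; apply/setDP; split; first exact: (dfs_done st xS yT exy).
  by apply: contraL yT => xyP; exact: (dfs_fresh st xyP (set22 x y)).
case: j cardS => [//|j] cardS.
apply: (sum_degree_ge_chunks cardS) => A AS cardA; rewrite leq_subLR.
apply: leq_trans (expG A cardA) _.
have cover : ext_nbhd e A \subset
    (S :\: A :|: [set x in U]) :|: (ext_nbhd e A :&: T).
  apply/subsetP => y yN; move: (yN); rewrite !inE => /andP[yA ->].
  by rewrite yA /=; case: (y \in S); case: (y \in U).
apply: leq_trans (subset_leq_card cover) _.
apply: leq_trans (leq_card_setU _ _) _; rewrite leq_add2r.
apply: leq_trans (leq_card_setU _ _) _; apply: leq_add.
  by rewrite cardsD (setIidPr AS) cardS cardA mulnS addKn.
by rewrite cardsE card_size.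
Qed.

(** * The likelihood ratio at the stopping time *)

(** Comparison of the retention probabilities (1 + mu) q and q on r retained and
    n absent edges, from 1 + x <= exp x: a retained edge has likelihood ratio
    1 + mu, and an absent one at most 1 - mu q because
    1 - (1 + mu) q <= (1 - mu q) (1 - q). *)
Lemma bernoulli_tilt (R : realType) (mu q : R) (r n : nat) :
  0 <= mu -> 0 <= q -> q < 1 -> (1 + mu) * q <= 1 ->
  ((1 + mu) * q) ^+ r * (1 - (1 + mu) * q) ^+ n
    <= expR (mu * (r%:R - q * n%:R)) * (q ^+ r * (1 - q) ^+ n).
Proof.
move=> mu0 q0 q1 p1.
have -> : mu * (r%:R - q * n%:R) = r%:R * mu + n%:R * (- (mu * q)) by ring.
have p0 : 0 <= (1 + mu) * q by rewrite mulr_ge0 // addr_ge0.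
have p1' : 0 <= 1 - (1 + mu) * q by rewrite subr_ge0.
rewrite expRD !expRM_natl mulrACA -!exprMn.
apply: ler_pM; rewrite ?exprn_ge0 //.
  apply: lerXn2r; rewrite ?nnegrE ?mulr_ge0 ?expR_ge0 ?addr_ge0 //.
  by rewrite ler_wpM2r // expR_ge1Dx.
apply: lerXn2r; rewrite ?nnegrE // ?mulr_ge0 ?expR_ge0 ?subr_ge0 ?(ltW q1) //.
apply: (@le_trans _ _ ((1 - mu * q) * (1 - q))); first by nra.
by rewrite ler_wpM2r ?subr_ge0 ?(ltW q1) // expR_ge1Dx.
Qed.

(** The deficit of retained edges at the stopping time, where K, D, J, u, r and
    n stand for k, d, j, the size of the stack and the numbers of retained and
    of absent edges. To leading order n is at least JKD (1 - eps / 2), so q n is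
    at least JK (1 + 9 eps / 10 - eps / 2), which exceeds JK by
    2 eps JK / 5 >= eps^2 KD / 5. Of this, half pays for u, a quarter absorbs
    the terms of higher order, and the last quarter is the deficit. For small D
    the number J may be much larger than eps D / 2; the lower bound on n suffers
    only from J - 1, the number of the other k-subsets, which is at most
    eps D / 2. *)
Lemma dfs_drift (R : realType) (eps q K D J u r n : R) :
  0 < eps -> eps <= 1 / 10 -> 0 <= K -> 0 <= D -> 0 <= q ->
  J - 1 <= eps * D / 2 -> eps * D / 2 <= J ->
  u <= eps ^+ 2 * (K * D) / 10 ->
  r <= K * J + u -> J * (K * D - (K * (J - 1) + u)) <= n ->
  1 + 9 / 10 * eps <= q * D ->
  r - q * n <= - (eps ^+ 2 / 20 * (K * D)).
Proof.
move=> eps0 eps1 K0 D0 q0 J1 J2 u1 r1 n1 qD.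
have J0 : 0 <= J by apply: le_trans J2; rewrite divr_ge0 // mulr_ge0 // ltW.
have JK0 : 0 <= J * K by exact: mulr_ge0.
have KJ1 : K * (J - 1) <= K * (eps * D / 2) by exact: ler_wpM2l.
have n2 : J * K * D * (1 - eps / 2 - eps ^+ 2 / 10) <= n.
  apply: le_trans n1.
  have -> : J * K * D * (1 - eps / 2 - eps ^+ 2 / 10) =
    J * (K * D - (K * (eps * D / 2) + eps ^+ 2 * (K * D) / 10)) by field.
  by apply: ler_wpM2l => //; lra.
have c0 : 0 <= 1 - eps / 2 - eps ^+ 2 / 10 by nra.
have qn : J * K * (1 + 3 / 10 * eps) <= q * n.
  apply: le_trans (ler_wpM2l q0 n2).
  have -> : q * (J * K * D * (1 - eps / 2 - eps ^+ 2 / 10)) =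
    J * K * ((q * D) * (1 - eps / 2 - eps ^+ 2 / 10)) by ring.
  apply: ler_wpM2l => //.
  by apply: le_trans (ler_wpM2r c0 qD); nra.
have JK : eps * D / 2 * K <= J * K by exact: ler_wpM2r.
have : 3 / 10 * eps * (eps * D / 2 * K) <= 3 / 10 * eps * (J * K).
  by apply: ler_wpM2l => //; lra.
have : 3 / 10 * eps * (eps * D / 2 * K) = 3 / 20 * (eps ^+ 2 * (K * D)) by field.
nra.
Qed.

Theorem theorem2 (R : realType) :
  exists eps0 : R, 0 < eps0 /\
  forall eps : R, 0 < eps -> eps <= eps0 ->
  exists gamma : R, 0 < gamma /\
  forall (k d : nat) (p : R), (0 < k)%N -> (0 < d)%N ->
    p = (1 + eps) / d%:R -> p <= 1 ->
  forall (V : finType) (e : rel V), symmetric e -> irreflexive e ->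
    (k <= #|V|)%N ->
    (forall S : {set V}, #|S| = k -> (k * d <= #|ext_nbhd e S|)%N) ->
  1 - expR (- (gamma * (k * d)%:R)) <=
  Gp_prob e p (fun F =>
    has_path_of_length_ge (adj F) (eps ^+ 2 * (k * d)%:R / 10)).
Proof.
exists (1 / 10); split; first by lra.
move=> eps eps0 eps1; exists (eps ^+ 3 / 400); split.
  by rewrite divr_gt0 // exprn_gt0.
move=> k d p k0 d0 pE p1 V e _ _ kV expG.
set L := eps ^+ 2 * _ / 10.
(* The tilted probability is still supercritical: q d >= 1 + 9 eps / 10. *)
pose mu := eps / 20; pose q := p / (1 + mu).
have dR : 0 < d%:R :> R by rewrite ltr0n.
have kR : 0 < k%:R :> R by rewrite ltr0n.
have mu0 : 0 < mu by rewrite divr_gt0.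
have mu1 : 0 < 1 + mu by rewrite addr_gt0.
have p0 : 0 < p by rewrite pE divr_gt0 ?addr_gt0.
have q0 : 0 < q by rewrite divr_gt0.
have pq : p = (1 + mu) * q by rewrite /q mulrC divfK // gt_eqF.
have q1 : q < 1 by apply: lt_le_trans p1; rewrite pq; nra.
have qd : 1 + 9 / 10 * eps <= q * d%:R.
  have -> : q * d%:R = (1 + eps) / (1 + mu).
    by rewrite /q pE; field; rewrite !gt_eqF.
  by rewrite ler_pdivlMr // /mu; nra.
(* The least integer above eps d / 2, so that j >= 1 even when d < 2 / eps. *)
pose j := (Num.truncn (eps * d%:R / 2)).+1.
have ed0 : 0 <= eps * d%:R / 2 by rewrite divr_ge0 // mulr_ge0 // ltW.
have jE : j%:R - 1 = j.-1%:R :> R by rewrite /j -natr1 addrK.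
have /andP[j1 j2] := truncn_itv ed0.
have jd : (j <= d.+1)%N.
  rewrite ltnS -(ler_nat R); apply: le_trans j1 _.
  by have : 0 <= d%:R :> R := ltW dR; nra.
(* S can grow to kj vertices: a k-set and its neighbourhood have at least k + kd
   vertices together. *)
have mV : (0 < k * j <= #|V|)%N.
  rewrite muln_gt0 k0 /=.
  have /card_geqP[s [us ss _]] : (k <= #|[set: V]|)%N by rewrite cardsT.
  have cardS : #|[set x in s]| = k by rewrite cardsE (card_uniqP us).
  have dis : [disjoint [set x in s] & ext_nbhd e [set x in s]].
    rewrite disjoints_subset; apply/subsetP => x xs.
    by rewrite in_setC inE negb_and negbK xs.
  apply: (@leq_trans (k + k * d)); first by rewrite -mulnS leq_mul2l jd orbT.
  apply: leq_trans (leq_add (eq_leq (esym cardS)) (expG _ cardS)) _.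
  have := (leq_card_setU [set x in s] (ext_nbhd e [set x in s])).2.
  by rewrite dis => /eqP <-; apply: max_card.
rewrite Gp_prob_compl lerD2l lerN2.
have qk t : 0 <= q ^+ t :> R by rewrite exprn_ge0 // ltW.
have qk' t : 0 <= (1 - q) ^+ t :> R by rewrite exprn_ge0 // subr_ge0 ltW.
apply: (dfs_cyl_mass_le (q := q) mV) => S x U P Q st cardS uniU pathU.
have [long|short] := lerP L (size U)%:R.
  rewrite [leLHS]big1 ?mulr_ge0 ?expR_ge0 // => F /and3P[_ /eqP FQ /asboolP[]].
  exists x, U; split=> //; apply: sub_path pathU => y z; rewrite /adj -FQ.
  by case/setIP.
apply: le_trans (cyl_mass_le _ (ltW p0) p1 (dfs_pos st) (dfs_queried st)) _.
rewrite pq; apply: le_trans (bernoulli_tilt _ _ (ltW mu0) (ltW q0) q1 _) _.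
  by rewrite -pq.
rewrite ler_wpM2r ?mulr_ge0 // ler_expR natrM.
have -> : - (eps ^+ 3 / 400 * (k%:R * d%:R)) =
  mu * - (eps ^+ 2 / 20 * (k%:R * d%:R)) by rewrite /mu; field.
rewrite ler_wpM2l ?(ltW mu0) //.
apply: (@dfs_drift _ _ _ _ _ j%:R (size U)%:R) => //;
  rewrite ?(ltW kR) ?(ltW dR) ?(ltW q0) //.
- by rewrite jE.
- exact: ltW.
- by rewrite -natrM ltW.
- by rewrite -natrM -natrD ler_nat -cardS (dfs_count st).
- have := dfs_negative_ge expG st cardS; rewrite -(ler_nat R); apply: le_trans.
  rewrite natrM ler_wpM2l // jE lerBlDr -!natrM -!natrD ler_nat addnC.
  by rewrite -leq_subLR.
Qed.
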